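(* Let $n\ge 1$ and let $L \in \mathcal{L}_n$. Then the number of $P_2$-matches in $L$, where $P_2=ENEN$, equals $\mathrm{bounce}^{-}(L)$. Hence, by symmetry, the number of $P_5$-matches in $L$, where $P_5=NENE$, equals $\mathrm{bounce}^{+}(L)$.
   Context: $\mathcal{L}_n$ is the set of lattice paths from $(0,0)$ to $(n,n)$ consisting of unit north steps $N=(0,1)$ and unit east steps $E=(1,0)$, equivalently words with $n$ letters $E$ and $n$ letters $N$. For $L\in\mathcal{L}_n$ and $A\subseteq\{1,\dots,n\}$, $ps_L(A)$ is the word obtained from $L$ by deleting, for every $i\in\{1,\dots,n\}\setminus A$, the $i$-th occurrence of $E$ and the $i$-th occurrence of $N$ (reading from left to right). For $P\in\mathcal{L}_2$, the number of $P$-matches in $L$ is the number of $j\in\{1,\dots,n-1\}$ with $ps_L(\{j,j+1\})=P$. $\mathrm{bounce}^{-}(L)$ is the number of points $(x,x)$ on $L$ such that the preceding step of $L$ is a north step and the following step is an east step. $\mathrm{bounce}^{+}(L)$ is the number of points $(y,y)$ on $L$ such that the preceding step is an east step and the following step is a north step. *)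

(* Defs.v *)
From HB Require Import structures.
From mathcomp Require Import all_boot.

Set Implicit Arguments.
Unset Strict Implicit.
Unset Printing Implicit Defensive.

Inductive step := E | N.

Definition is_north (s : step) : bool := if s is N then true else false.
Definition step_of_bool (b : bool) : step := if b then N else E.

Lemma is_northK : cancel is_north step_of_bool.
Proof. by case. Qed.

HB.instance Definition _ := Equality.copy step (can_type is_northK).

Definition lattice_path (n : nat) : {pred seq step} :=
  [pred L | (count_mem E L == n) && (count_mem N L == n)].

(* Positions in a word are numbered from 0, occurrences of a letter from 1:
   the letter at position k is the (occurrence L k)-th one of its kind. *)
Definition occurrence (L : seq step) (k : nat) : nat :=
  count_mem (nth E L k) (take k.+1 L).

(* Elements of A outside {1, ..., n} are never occurrence numbers in a path of
   lattice_path n, so A may be any predicate on nat. *)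
Definition ps (L : seq step) (A : {pred nat}) : seq step :=
  [seq nth E L k | k <- iota 0 (size L) & occurrence L k \in A].

Definition matches (n : nat) (P L : seq step) : nat :=
  count (fun j => ps L (pred2 j j.+1) == P) (index_iota 1 n).

(* The point reached after k steps. *)
Definition point (L : seq step) (k : nat) : nat * nat :=
  (count_mem E (take k L), count_mem N (take k L)).

(* Every (x, x) on L is some point L k, for a unique k; the range 1 <= k < size L
   ensures that there are both a preceding step (at position k.-1) and a
   following one (at position k). *)
Definition diagonal_turns (s t : step) (L : seq step) : nat :=
  count (fun k => [&& (point L k).1 == (point L k).2,
                      nth E L k.-1 == s & nth E L k == t])
        (index_iota 1 (size L)).

Definition bounce_minus (L : seq step) : nat := diagonal_turns N E L.

Definition bounce_plus (L : seq step) : nat := diagonal_turns E N L.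

(* Main.v *)
(* Write [w_k] for the subword of [ps L {j, j+1}] coming from the first [k]
   letters of [L].  It contains a letter [x] as often as [j] and [j+1] are at
   most the number of [x]'s among these [k] letters.  If [ps L {j, j+1}] is the
   alternating word [stst], then every [w_k] is one of its prefixes; for
   [k = 2j-1, 2j, 2j+1] the only possible pairs of numbers of [s]'s and [t]'s
   are then [(j, j-1)], [(j, j)] and [(j+1, j)], which is a turn [ts] at the
   diagonal point [(j, j)].  Conversely, these three pairs force [w_k] to be
   [s], [st] and [sts], and the one remaining letter is a [t]. *)
Require Import Defs.
From mathcomp Require Import all_boot zify.

(** A new last letter leaves all earlier occurrence numbers unchanged, so [ps] can be analysed by
    induction from the right end. *)
Lemma ps_rcons (L : seq step) (x : step) (A : {pred nat}) :
  ps (rcons L x) A =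
  if (count_mem x L).+1 \in A then rcons (ps L A) x else ps L A.
Proof.
have nth_last : nth E (rcons L x) (size L) = x by rewrite nth_rcons ltnn eqxx.
have occ_last : occurrence (rcons L x) (size L) = (count_mem x L).+1.
  by rewrite /occurrence nth_last -(size_rcons L x) take_size -cats1 count_cat
             /= eqxx addn0 addn1.
have -> : ps L A = [seq nth E (rcons L x) k |
                    k <- iota 0 (size L) & occurrence (rcons L x) k \in A].
  have nthE k : k \in iota 0 (size L) -> nth E (rcons L x) k = nth E L k.
    by rewrite mem_iota nth_rcons => /= ->.
  rewrite /ps (@eq_in_filter _ _ (fun k => occurrence (rcons L x) k \in A)).
    apply/eq_in_map => k; rewrite mem_filter => /andP[_ /nthE ->] //.
  move=> k kL; rewrite /occurrence nthE //.
  by move: kL; rewrite mem_iota -cats1 => /= kL; rewrite takel_cat.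
rewrite {1}/ps size_rcons -addn1 iotaD add0n filter_cat map_cat /= occ_last.
by case: ifP => _; rewrite ?cats0 //= nth_last cats1.
Qed.

Lemma prefix_ps_take (L : seq step) (k : nat) (A : {pred nat}) :
  prefix (ps (take k L) A) (ps L A).
Proof.
rewrite -{2}(cat_take_drop k L); elim/last_ind: (drop k L) => [|L' x IH].
  by rewrite cats0 prefix_refl.
rewrite -rcons_cat ps_rcons; case: ifP => // _.
exact: prefix_trans IH (prefix_rcons _ _).
Qed.

Lemma count_ps_pred2 (L : seq step) (x : step) (j : nat) : 0 < j ->
  count_mem x (ps L (pred2 j j.+1)) =
  (j <= count_mem x L) + (j < count_mem x L).
Proof.
move=> j0; elim/last_ind: L => [|L y IH]; first by case: j j0.
rewrite ps_rcons -[in RHS]cats1 count_cat /= addn0.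
case: (eqVneq y x) => [->|yx].
  (* The new letter is kept when its number [c.+1] is [j] or [j.+1], exactly when one of the two
     comparisons becomes true. *)
  rewrite inE /= eqSS; move: (count_mem x L) IH => c IH.
  by case: ifP => jc; rewrite -?cats1 ?count_cat /= ?eqxx IH; lia.
by rewrite addn0 -IH; case: ifP => // _; rewrite -cats1 count_cat /= (negPf yx) !addn0.
Qed.

Lemma count_take_succ (L : seq step) (x : step) (k : nat) : k < size L ->
  count_mem x (take k.+1 L) = count_mem x (take k L) + (nth E L k == x).
Proof. by move=> kL; rewrite (take_nth E) // -cats1 count_cat /= addn0. Qed.

Section DistinctLetters.
Variables s t : step.
Hypothesis neq_st : s != t.

Lemma size_count (L : seq step) : size L = count_mem s L + count_mem t L.
Proof.
rewrite -(count_predC (pred1 s)); congr (_ + _); apply: eq_count => x /=.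
by move: neq_st; case: s; case: t; case: x.
Qed.

Lemma count_diag (L : seq step) (k : nat) :
  ((point L k).1 == (point L k).2) =
  (count_mem s (take k L) == count_mem t (take k L)).
Proof. by move: neq_st; case: s; case: t => //= _; rewrite eq_sym. Qed.

Lemma seq1_count (L : seq step) :
  count_mem s L = 1 -> count_mem t L = 0 -> L = [:: s].
Proof.
move=> cs ct; have := size_count L; rewrite cs ct.
by case: L cs {ct} => [|x [|]] //=; case: eqP => // ->.
Qed.

Lemma count_prefix_alternating (w : seq step) : prefix w [:: s; t; s; t] ->
  count_mem t w <= count_mem s w <= (count_mem t w).+1.
Proof.
(* A prefix is determined by its length, which leaves five words to check. *)
rewrite prefixE => /eqP <-.
have ts : (t == s) = false by rewrite eq_sym (negPf neq_st).
by case: (size w) => [|[|[|[|k]]]] /=; rewrite ?eqxx ?ts ?(negPf neq_st).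
Qed.

End DistinctLetters.

Lemma match_diagonal_turn (s t : step) (n : nat) (L : seq step) (j : nat) :
    s != t -> L \in lattice_path n -> 0 < j < n ->
  (ps L (pred2 j j.+1) == [:: s; t; s; t]) =
  [&& (point L j.*2).1 == (point L j.*2).2,
      nth E L j.*2.-1 == t & nth E L j.*2 == s].
Proof.
move=> neq_st hL /andP[j0 jn]; have neq_ts : t != s by rewrite eq_sym.
have cL x : count_mem x L = n by case/andP: hL => /eqP cE /eqP cN; case: x.
have szL : size L = n + n by rewrite (@size_count s t) // !cL.
have sz k : k <= n + n -> count_mem s (take k L) + count_mem t (take k L) = k.
  by move=> kn; rewrite -(@size_count s t) // size_takel ?szL.
have lt1 : j.*2.-1 < size L by lia.
have lt2 : j.*2 < size L by lia.
have j2 : j.*2.-1.+1 = j.*2 by lia.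
have sz1 := sz j.*2.-1 ltac:(lia); have sz2 := sz j.*2 ltac:(lia).
have sz3 := sz j.*2.+1 ltac:(lia).
have step1 x := @count_take_succ L x _ lt1; rewrite j2 in step1.
have step2 x := @count_take_succ L x _ lt2.
rewrite (@count_diag s t) //; apply/idP/idP => [/eqP psL|].
  have alt k := @count_prefix_alternating s t neq_st _
                  (eq_ind _ (prefix _) (prefix_ps_take L k (pred2 j j.+1)) _ psL).
  have := (alt j.*2.-1, alt j.*2, alt j.*2.+1); rewrite !count_ps_pred2 //.
  move=> [[alt1 alt2] alt3].
  (* Differences of consecutive counts identify the two letters around the diagonal point. *)
  have := (step1 s, step1 t, step2 s, step2 t) => -[[[s1 t1] s2] t2].
  by apply/and3P; split; lia.
case/and3P => /eqP diag /eqP Lt /eqP Ls.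
have cs2 : count_mem s (take j.*2 L) = j by lia.
have ct2 : count_mem t (take j.*2 L) = j by lia.
have cs1 : count_mem s (take j.*2.-1 L) = j.
  by rewrite -[RHS]cs2 step1 Lt (negPf neq_ts) addn0.
have ct1 : (count_mem t (take j.*2.-1 L)).+1 = j.
  by rewrite -[RHS]ct2 step1 Lt eqxx addn1.
have w1 : ps (take j.*2.-1 L) (pred2 j j.+1) = [:: s].
  by apply: (@seq1_count s t) => //; rewrite count_ps_pred2 //; lia.
(* This [t] is the [j]-th of its kind and the following [s] the [j.+1]-th, so both are kept. *)
have w2 : ps (take j.*2 L) (pred2 j j.+1) = [:: s; t].
  by rewrite -j2 (take_nth E) // ps_rcons Lt ct1 inE /= eqxx w1.
have w3 : ps (take j.*2.+1 L) (pred2 j j.+1) = [:: s; t; s].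
  by rewrite (take_nth E) // ps_rcons Ls cs2 inE /= eqxx orbT w2.
have /prefixP[v psL] := prefix_ps_take L j.*2.+1 (pred2 j j.+1).
have cnt x := @count_ps_pred2 L x j j0.
(* Since [j < n], each letter occurs twice in [ps L]; after [sts] only one [t] is left for [v]. *)
have := (cnt s, cnt t); rewrite psL w3 !cL /= !eqxx (negPf neq_st) (negPf neq_ts).
by rewrite jn (ltnW jn) => -[[vs] [vt]]; rewrite (@seq1_count t s _ v).
Qed.

Lemma count_even (Q : pred nat) (n : nat) : (forall k, Q k -> ~~ odd k) ->
  count Q (index_iota 1 n.*2) = count (fun j => Q j.*2) (index_iota 1 n).
Proof.
move=> evenQ; have oddQ k : Q k.*2.+1 = false.
  by apply/negP => /evenQ; rewrite /= odd_double.
(* The first range grows by two numbers only from [n = 1] on: it is empty for 0 and consists of 1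
   alone for 1. *)
elim: n => [|[|n] IH] //; first by rewrite /= (oddQ 0).
rewrite /index_iota in IH *.
have -> : n.+2.*2 - 1 = (n.+1.*2 - 1) + 2 by lia.
have -> : n.+2 - 1 = (n.+1 - 1) + 1 by lia.
rewrite !iotaD !count_cat IH; congr (_ + _) => /=.
have -> : 1 + (n.+1.*2 - 1) = n.+1.*2 by lia.
by rewrite oddQ subn1 add1n.
Qed.

(** A diagonal point is reached only after an even number [j.*2] of steps, and a turn there
    corresponds to the match at [j]. Exchanging [s] and [t] is the symmetry between the two claims
    of the theorem. *)
Lemma matches_alternating (s t : step) (n : nat) (L : seq step) :
    s != t -> L \in lattice_path n ->
  matches n [:: s; t; s; t] L = diagonal_turns t s L.
Proof.
move=> neq_st hL; have [/eqP cE /eqP cN] := andP hL.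
have szL : size L = n.*2 by rewrite (@size_count E N) // cE cN addnn.
rewrite /diagonal_turns szL /matches.
(* The bound gives [take k L] length [k], so that equal counts make [k] even; past the end the point
   stays [(n, n)] for either parity. *)
transitivity (count (fun k => [&& k < n.*2, (point L k).1 == (point L k).2,
                      nth E L k.-1 == t & nth E L k == s]) (index_iota 1 n.*2)).
  rewrite count_even; last first.
    move=> k /and3P[kn /eqP]; rewrite /point /= => diag _.
    have := @size_count E N isT (take k L); rewrite diag size_takel ?szL 1?ltnW //.
    by move->; rewrite addnn odd_double.
  apply: eq_in_count => j; rewrite mem_index_iota => jn.
  by rewrite (@match_diagonal_turn s t n) // ltn_double; case/andP: jn => _ ->.
by apply: eq_in_count => k; rewrite mem_index_iota => /andP[_ ->].
Qed.

Theorem theorem4 (n : nat) (L : seq step) (hn : 1 <= n)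
    (hL : L \in lattice_path n) :
  matches n [:: E; N; E; N] L = bounce_minus L /\
  matches n [:: N; E; N; E] L = bounce_plus L.
Proof. by split; apply: matches_alternating. Qed.
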